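(* Let $\gamma=\gamma(\nu_3)$ be an axially symmetric anisotropic energy density. Let $\omega,C\in\mathbf{R}$, let $(x(s),y(s))$ be a plane curve parameterized by arc length, the generating curve of the helicoidal surface $$X=\bigl([x(s)+iy(s)]e^{-i\omega\vartheta},\ \vartheta+C\bigr),$$ and put $\eta_1(s)=-\tfrac12\,\partial_s\bigl[(x(s))^2+(y(s))^2\bigr]$, $\eta_2(s)=x\,y_s-y\,x_s$. Suppose that the curve $(\eta_1,\eta_2)$ satisfies $$\Lambda(\eta_1^2+\eta_2^2)+\frac{2\eta_2}{\mu_2\!\left(\frac{\omega\eta_1}{\sqrt{1+\omega^2\eta_1^2}}\right)\sqrt{1+\omega^2\eta_1^2}}+A\equiv 0$$ with real constants $\Lambda,A$. Then the generating curve $(x,y)$ can be recovered from the curve $(\eta_1,\eta_2)$ by the formula $$x+iy=-(\eta_1+i\eta_2)\exp\Bigl(-i\int\frac{d\eta_2}{\eta_1}\Bigr).$$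
   Context: The $x_1x_2$-plane of $\mathbf{R}^3$ is identified with $\mathbf{C}$. An anisotropic energy density is a smooth function $\gamma:S^2\to\mathbf{R}$ whose Wulff shape $W=\partial\bigcap_{n\in S^2}\{Y\in\mathbf{R}^3: Y\cdot n\le\gamma(n)\}$ is assumed to be a smooth convex surface with uniformly positive curvature; $\gamma$ is the support function of $W$. It is axially symmetric if $\gamma$ depends only on the third component $\nu_3$ of $\nu\in S^2$; then $\mu_2$ is defined by $1/\mu_2(\nu_3)=\gamma(\nu_3)-\nu_3\gamma'(\nu_3)$. *)

(* Defs.v *)
From Stdlib Require Import Reals.
From Coquelicot Require Import Coquelicot.
Open Scope R_scope.

(** * Euclidean space; [R * R * R] is [C * R], so that the x1x2-plane is [C] *)

Notation R2 := (R * R)%type.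
Notation R3 := (R * R * R)%type.

Definition coord1 (p : R3) : R := fst (fst p).
Definition coord2 (p : R3) : R := snd (fst p).
Definition coord3 (p : R3) : R := snd p.

Definition dot (p q : R3) : R :=
  coord1 p * coord1 q + coord2 p * coord2 q + coord3 p * coord3 q.

Definition cross (p q : R3) : R3 :=
  (coord2 p * coord3 q - coord3 p * coord2 q,
   coord3 p * coord1 q - coord1 p * coord3 q,
   coord1 p * coord2 q - coord2 p * coord1 q).

Definition norm3 (p : R3) : R := sqrt (dot p p).

Definition scal3 (t : R) (p : R3) : R3 :=
  (t * coord1 p, t * coord2 p, t * coord3 p).

Definition S2 (n : R3) : Prop := dot n n = 1.

Definition boundary (D : R3 -> Prop) (p : R3) : Prop :=
  ~ locally p D /\ ~ locally p (fun q => ~ D q).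

Definition convex (D : R3 -> Prop) : Prop :=
  forall (p q : R3) (t : R), D p -> D q -> 0 <= t <= 1 ->
    D (plus (scal3 (1 - t) p) (scal3 t q)).

(** * Smooth functions of several variables *)

Definition dir_deriv {V : NormedModule R_AbsRing} (v : V) (f : V -> R) (p : V) : R :=
  Derive (fun t : R => f (plus p (scal t v))) 0.

(* On an open subset of a finite-dimensional space this is the usual class C^n:
   all iterated directional derivatives of order at most n exist and are
   continuous. *)
Fixpoint Cn_on {V : NormedModule R_AbsRing} (n : nat) (U : V -> Prop) (f : V -> R)
  : Prop :=
  (forall p, U p -> continuous f p) /\
  match n with
  | O => True
  | S m => forall v : V,
      (forall p, U p -> ex_derive (fun t : R => f (plus p (scal t v))) 0) /\
      Cn_on m U (dir_deriv v f)
  end.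

Definition smooth_on {V : NormedModule R_AbsRing} (U : V -> Prop) (f : V -> R) : Prop :=
  forall n, Cn_on n U f.

(* Only the values of [gamma] on the sphere matter. *)
Definition smooth_on_S2 (gamma : R3 -> R) : Prop :=
  exists (U : R3 -> Prop) (F : R3 -> R),
    open U /\ (forall n, S2 n -> U n) /\ smooth_on U F /\
    (forall n, S2 n -> F n = gamma n).

(** * Regular surfaces in [R3] and their Gauss curvature *)

Definition dir_deriv3 (v : R2) (X : R2 -> R3) (u : R2) : R3 :=
  (dir_deriv v (fun w : R2 => coord1 (X w)) u,
   dir_deriv v (fun w : R2 => coord2 (X w)) u,
   dir_deriv v (fun w : R2 => coord3 (X w)) u).

Definition d_u : (R2 -> R3) -> R2 -> R3 := dir_deriv3 (1, 0).
Definition d_v : (R2 -> R3) -> R2 -> R3 := dir_deriv3 (0, 1).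

(* [X] is a smooth immersion of the open set [U] that is a homeomorphism onto
   the relatively open subset [W] /\ [V] of [W], with inverse [Y]. *)
Definition local_parametrization (W : R3 -> Prop) (U : R2 -> Prop) (V : R3 -> Prop)
    (X : R2 -> R3) : Prop :=
  open U /\ open V /\
  smooth_on U (fun u : R2 => coord1 (X u)) /\
  smooth_on U (fun u : R2 => coord2 (X u)) /\
  smooth_on U (fun u : R2 => coord3 (X u)) /\
  (forall u, U u -> cross (d_u X u) (d_v X u) <> (0, 0, 0)) /\
  exists Y : R3 -> R2,
    (forall u, U u -> W (X u) /\ V (X u) /\ Y (X u) = u) /\
    (forall p, W p -> V p -> U (Y p) /\ X (Y p) = p) /\
    (forall p, W p -> V p -> filterlim Y (within W (locally p)) (locally (Y p))).

Definition smooth_surface (W : R3 -> Prop) : Prop :=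
  forall p, W p -> exists (U : R2 -> Prop) (V : R3 -> Prop) (X : R2 -> R3),
    local_parametrization W U V X /\ V p.

Definition unit_normal (X : R2 -> R3) (u : R2) : R3 :=
  let m := cross (d_u X u) (d_v X u) in scal3 (/ norm3 m) m.

Definition gauss_curvature (X : R2 -> R3) (u : R2) : R :=
  let E := dot (d_u X u) (d_u X u) in
  let F := dot (d_u X u) (d_v X u) in
  let G := dot (d_v X u) (d_v X u) in
  let e := dot (unit_normal X u) (d_u (d_u X) u) in
  let f := dot (unit_normal X u) (d_v (d_u X) u) in
  let g := dot (unit_normal X u) (d_v (d_v X) u) in
  (e * g - f ^ 2) / (E * G - F ^ 2).

Definition uniformly_positive_curvature (W : R3 -> Prop) : Prop :=
  exists k : R, 0 < k /\
    forall (U : R2 -> Prop) (V : R3 -> Prop) (X : R2 -> R3),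
      local_parametrization W U V X -> forall u, U u -> k <= gauss_curvature X u.

Definition convex_surface (W : R3 -> Prop) : Prop :=
  exists D : R3 -> Prop,
    convex D /\ (exists p, locally p D) /\ (forall p, W p <-> boundary D p).

(** * Anisotropic energy densities *)

Definition wulff_shape (gamma : R3 -> R) : R3 -> Prop :=
  boundary (fun Y : R3 => forall n, S2 n -> dot Y n <= gamma n).

Definition support_function_of (W : R3 -> Prop) (h : R3 -> R) : Prop :=
  forall n, S2 n -> is_lub (fun r => exists Y, W Y /\ r = dot Y n) (h n).

Record anisotropic_energy_density (gamma : R3 -> R) : Prop := {
  aed_smooth : smooth_on_S2 gamma;
  aed_surface : smooth_surface (wulff_shape gamma);
  aed_convex : convex_surface (wulff_shape gamma);
  aed_curvature : uniformly_positive_curvature (wulff_shape gamma);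
  aed_support : support_function_of (wulff_shape gamma) gamma
}.

Definition axially_symmetric (gamma : R3 -> R) (g : R -> R) : Prop :=
  forall n, S2 n -> gamma n = g (coord3 n).

(* 1 / mu2 = gamma - nu3 * gamma', to be used on the open interval (-1, 1), where
   the derivative of [g] depends only on the density. *)
Definition mu2 (g : R -> R) (nu3 : R) : R := / (g nu3 - nu3 * Derive g nu3).

(** * Curves on an open, possibly unbounded, interval *)

Definition in_interval (a b : Rbar) (s : R) : Prop := Rbar_lt a s /\ Rbar_lt s b.

Definition Ck_on_interval (k : nat) (a b : Rbar) (f : R -> R) : Prop :=
  forall (j : nat) (s : R), (j <= k)%nat -> in_interval a b s ->
    ex_derive_n f j s /\ continuous (Derive_n f j) s.

Definition arc_length_curve (a b : Rbar) (x y : R -> R) : Prop :=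
  Ck_on_interval 2 a b x /\ Ck_on_interval 2 a b y /\
  forall s, in_interval a b s -> Derive x s ^ 2 + Derive y s ^ 2 = 1.

Definition eta1 (x y : R -> R) (s : R) : R :=
  - (1 / 2) * Derive (fun t => x t ^ 2 + y t ^ 2) s.

Definition eta2 (x y : R -> R) (s : R) : R :=
  x s * Derive y s - y s * Derive x s.

Definition Cexp (z : C) : C :=
  (exp (Re z) * (cos (Im z) + Ci * sin (Im z)))%C.

Definition helicoidal_surface (omega c : R) (x y : R -> R) (s theta : R) : C * R :=
  (((x s + Ci * y s) * Cexp (- (Ci * (omega * theta)%R)))%C, theta + c).

(* [Phi] is a determination of the indefinite integral of d h2 / h1 along a curve
   (h1, h2): a C^1 function whose derivative is h2' / h1 wherever this quotient is
   meaningful. Continuity of [Phi'] removes any freedom at zeros of [h1] that are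
   limits of non-zeros; an isolated zero, for instance, causes no ambiguity. *)
Definition indefinite_integral (a b : Rbar) (h1 h2 Phi : R -> R) : Prop :=
  Ck_on_interval 1 a b Phi /\
  forall s, in_interval a b s -> h1 s <> 0 -> Derive Phi s = Derive h2 s / h1 s.

(* The integrand d h2 / h1 is defined on a dense subset of the interval. *)
Definition densely_nonzero (a b : Rbar) (h : R -> R) : Prop :=
  forall s, in_interval a b s -> forall eps : posreal,
    exists t, in_interval a b t /\ Rabs (t - s) < eps /\ h t <> 0.

(* Main.v *)
Require Import Defs.
From Stdlib Require Import Reals Lra Lia Classical.
From Coquelicot Require Import Coquelicot.
Open Scope R_scope.

(** Write [z = x + i y]. Since [(x, y)] has unit speed, [z' = exp (i theta)] for a
    tangent angle [theta], and by definition [eta1] and [eta2] are, up to sign, the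
    tangential and normal components of [z]:
    [conj z * z' = - eta1 + i eta2], that is, [z = - (eta1 + i eta2) exp (i theta)].
    It remains to identify [- theta] with the integral of [d eta2 / eta1]. If [kappa]
    is the curvature, then [theta' = kappa], and Frenet's equation [z'' = i kappa z']
    gives [eta2' = kappa (x x' + y y') = - kappa eta1], hence
    [- theta' = eta2' / eta1] wherever [eta1] does not vanish.

    The analytic content is the existence of a differentiable tangent angle
    ([exists_angle]), obtained by integrating [kappa] from a correct initial angle.
    For an arbitrary determination [Phi] of the integral, [Phi'] and [- theta'] are
    continuous and agree on a dense set, so [Phi] and [- theta] differ by a constant
    ([indefinite_integral_unique]). *)

(** * Calculus on an open interval *)

Lemma in_interval_locally (a b : Rbar) (s : R) :
  in_interval a b s -> locally s (in_interval a b).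
Proof.
intros [Ha Hb].
exact (filter_and _ _ (open_Rbar_gt' _ _ Ha) (open_Rbar_lt' _ _ Hb)).
Qed.

Lemma in_interval_between (a b : Rbar) (s t u : R) :
  in_interval a b s -> in_interval a b t -> Rmin s t <= u <= Rmax s t ->
  in_interval a b u.
Proof.
intros [Has Hsb] [Hat Htb].
unfold Rmin, Rmax; destruct (Rle_dec s t); intros [H1 H2]; split;
  destruct a, b; simpl in *; lra || easy.
Qed.

Lemma derive_zero_constant (a b : Rbar) (f : R -> R) (s t : R) :
  (forall u, in_interval a b u -> is_derive f u 0) ->
  in_interval a b s -> in_interval a b t -> f s = f t.
Proof.
intros Hf Hs Ht.
destruct (MVT_gen f t s (fun _ => 0)) as [u [_ Hu]].
- intros u Hu. apply Hf, (in_interval_between a b t s); [easy | easy | lra].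
- intros u Hu. apply continuity_pt_filterlim, (ex_derive_continuous f u).
  exists 0. apply Hf, (in_interval_between a b t s); [easy | easy | lra].
- lra.
Qed.

Lemma exists_primitive (a b : Rbar) (h : R -> R) (s0 v : R) :
  in_interval a b s0 ->
  (forall s, in_interval a b s -> continuous h s) ->
  exists F, F s0 = v /\ forall s, in_interval a b s -> is_derive F s (h s).
Proof.
intros Hs0 Hh.
exists (fun s => v + RInt h s0 s); split.
- rewrite RInt_point. apply Rplus_0_r.
- intros s Hs.
  rewrite <- (Rplus_0_l (h s)).
  apply (is_derive_plus (fun _ => v) (fun s => RInt h s0 s)).
  + apply (is_derive_const v s).
  + apply (is_derive_RInt h (fun s => RInt h s0 s) s0 s).
    * apply (filter_imp (in_interval a b)); [| now apply in_interval_locally].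
      intros t Ht. apply (RInt_correct h s0 t), ex_RInt_continuous.
      intros u Hu. apply Hh, (in_interval_between a b s0 t); easy.
    * now apply Hh.
Qed.

Lemma continuous_eq_of_dense (a b : Rbar) (h f k : R -> R) :
  densely_nonzero a b h ->
  (forall s, in_interval a b s -> continuous f s) ->
  (forall s, in_interval a b s -> continuous k s) ->
  (forall s, in_interval a b s -> h s <> 0 -> f s = k s) ->
  forall s, in_interval a b s -> f s = k s.
Proof.
intros Hd Hf Hk Hfk s Hs.
assert (Hm : continuous (fun t => f t - k t) s)
  by exact (continuous_minus f k s (Hf s Hs) (Hk s Hs)).
destruct (Req_dec (f s - k s) 0) as [H0 | H0]; [lra | exfalso].
destruct (proj1 (filterlim_locally _ _) Hm (mkposreal _ (Rabs_pos_lt _ H0)))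
  as [eps Heps].
destruct (Hd s Hs eps) as [t [Ht [Hst Hht]]].
assert (H := Heps t Hst).
change (Rabs ((f t - k t) - (f s - k s)) < Rabs (f s - k s)) in H.
rewrite (Hfk t Ht Hht) in H.
replace (k t - k t - (f s - k s)) with (- (f s - k s)) in H by ring.
rewrite Rabs_Ropp in H; lra.
Qed.

(** Two determinations have continuous derivatives that agree off the zeros of the
    denominator, hence everywhere. *)
Lemma indefinite_integral_unique (a b : Rbar) (h1 h2 Phi Psi : R -> R) :
  densely_nonzero a b h1 ->
  indefinite_integral a b h1 h2 Phi -> indefinite_integral a b h1 h2 Psi ->
  exists phi0, forall s, in_interval a b s -> Psi s = Phi s + phi0.
Proof.
intros Hd [HPhi HdPhi] [HPsi HdPsi].
destruct (classic (exists s0, in_interval a b s0)) as [[s0 Hs0] | Hempty];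
  [| exists 0; intros s Hs; exfalso; apply Hempty; now exists s].
assert (Heq : forall s, in_interval a b s -> Derive Psi s = Derive Phi s).
{ apply (continuous_eq_of_dense a b h1); [easy | | |].
  - intros s Hs. now apply (HPsi 1%nat s).
  - intros s Hs. now apply (HPhi 1%nat s).
  - intros s Hs Hh. now rewrite HdPhi, HdPsi. }
exists (Psi s0 - Phi s0). intros s Hs.
assert (H : Psi s - Phi s = Psi s0 - Phi s0); [| lra].
apply (derive_zero_constant a b (fun u => Psi u - Phi u)); [| easy | easy].
intros u Hu.
replace 0 with (Derive Psi u - Derive Phi u) by (rewrite (Heq u Hu); ring).
apply (is_derive_minus Psi Phi u); apply Derive_correct.
- now apply (HPsi 1%nat u).
- now apply (HPhi 1%nat u).
Qed.

(** * The angle of a unit vector field *)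

Lemma exists_polar_angle (u v : R) :
  u ^ 2 + v ^ 2 = 1 -> exists t, u = cos t /\ v = sin t.
Proof.
intros Huv.
assert (Hu : -1 <= u <= 1) by (split; nra).
assert (Hv : sqrt (1 - Rsqr u) = Rabs v).
{ rewrite <- sqrt_Rsqr_abs. f_equal. unfold Rsqr. lra. }
destruct (Rle_dec 0 v) as [Hpos | Hneg].
- exists (acos u). rewrite cos_acos, sin_acos, Hv, Rabs_pos_eq; lra.
- exists (- acos u).
  rewrite cos_neg, sin_neg, cos_acos, sin_acos, Hv, Rabs_left; lra.
Qed.

(** A unit vector field stays orthogonal to its derivative, so the latter is
    [u v' - v u'] times the field rotated by a right angle. *)
Lemma unit_field_derive (a b : Rbar) (u v : R -> R) (s : R) :
  (forall t, in_interval a b t -> u t ^ 2 + v t ^ 2 = 1) ->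
  in_interval a b s -> ex_derive u s -> ex_derive v s ->
  Derive u s = - (u s * Derive v s - v s * Derive u s) * v s /\
  Derive v s = (u s * Derive v s - v s * Derive u s) * u s.
Proof.
intros Hunit Hs Hu Hv.
assert (Horth : u s * Derive u s + v s * Derive v s = 0).
{ assert (H0 : is_derive (fun t => u t ^ 2 + v t ^ 2) s 0).
  { apply (is_derive_ext_loc (fun _ => 1)); [| apply (is_derive_const 1 s)].
    apply (filter_imp (in_interval a b)); [| now apply in_interval_locally].
    intros t Ht. now rewrite Hunit. }
  assert (H1 : is_derive (fun t => u t ^ 2 + v t ^ 2) s
                 (2 * (u s * Derive u s + v s * Derive v s))).
  { auto_derive; [easy | ]. change (Derive (fun x => u x)) with (Derive u).
    change (Derive (fun x => v x)) with (Derive v). ring. }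
  apply is_derive_unique in H0. apply is_derive_unique in H1. lra. }
assert (Hs1 := Hunit s Hs).
split.
- replace (Derive u s) with (Derive u s * (u s ^ 2 + v s ^ 2)
    - u s * (u s * Derive u s + v s * Derive v s)) at 1
    by (rewrite Hs1, Horth; ring). ring.
- replace (Derive v s) with (Derive v s * (u s ^ 2 + v s ^ 2)
    - v s * (u s * Derive u s + v s * Derive v s)) at 1
    by (rewrite Hs1, Horth; ring). ring.
Qed.

Lemma continuous_angular_speed (u v : R -> R) (s : R) :
  ex_derive u s -> continuous (Derive u) s ->
  ex_derive v s -> continuous (Derive v) s ->
  continuous (fun t => u t * Derive v t - v t * Derive u t) s.
Proof.
intros Hu Hu' Hv Hv'.
assert (Cu : continuous u s) by exact (ex_derive_continuous u s Hu).
assert (Cv : continuous v s) by exact (ex_derive_continuous v s Hv).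
apply (continuous_minus (fun t => u t * Derive v t) (fun t => v t * Derive u t)).
- exact (continuous_mult u (Derive v) s Cu Hv').
- exact (continuous_mult v (Derive u) s Cv Hu').
Qed.

(** The angle must have derivative [u v' - v u'], so it is found by integration; its
    cosine and sine give a unit field with the same rotation speed and the same
    initial value as [(u, v)], so the inner product of the two fields is constantly
    [1], which forces them to coincide. *)
Lemma exists_angle (a b : Rbar) (u v : R -> R) :
  (forall s, in_interval a b s -> ex_derive u s /\ continuous (Derive u) s) ->
  (forall s, in_interval a b s -> ex_derive v s /\ continuous (Derive v) s) ->
  (forall s, in_interval a b s -> u s ^ 2 + v s ^ 2 = 1) ->
  exists theta, forall s, in_interval a b s ->
    is_derive theta s (u s * Derive v s - v s * Derive u s) /\
    u s = cos (theta s) /\ v s = sin (theta s).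
Proof.
intros Hu Hv Hunit.
destruct (classic (exists s0, in_interval a b s0)) as [[s0 Hs0] | Hempty];
  [| exists (fun _ => 0); intros s Hs; exfalso; apply Hempty; now exists s].
destruct (exists_polar_angle (u s0) (v s0) (Hunit s0 Hs0)) as [t0 [Hc0 Hs0']].
destruct (exists_primitive a b (fun s => u s * Derive v s - v s * Derive u s) s0 t0)
  as [theta [Ht0 Htheta]]; [easy | |].
{ intros s Hs. destruct (Hu s Hs) as [Hu1 Hu2], (Hv s Hs) as [Hv1 Hv2].
  now apply continuous_angular_speed. }
exists theta. intros s Hs. split; [now apply Htheta |].
assert (Hinner : u s * cos (theta s) + v s * sin (theta s) = 1).
{ transitivity (u s0 * cos (theta s0) + v s0 * sin (theta s0)).
  2: { rewrite Ht0, <- Hc0, <- Hs0', <- (Hunit s0 Hs0). ring. }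
  apply (derive_zero_constant a b
           (fun r => u r * cos (theta r) + v r * sin (theta r))); [| easy | easy].
  intros r Hr.
  destruct (Hu r Hr) as [Hu1 _], (Hv r Hr) as [Hv1 _].
  assert (Hth := Htheta r Hr).
  destruct (unit_field_derive a b u v r Hunit Hr Hu1 Hv1) as [Du Dv].
  assert (Hex : ex_derive theta r) by exact (ex_intro _ _ Hth).
  auto_derive.
  - easy.
  - change (Derive (fun x => u x)) with (Derive u).
    change (Derive (fun x => v x)) with (Derive v).
    change (Derive (fun x => theta x)) with (Derive theta).
    rewrite (is_derive_unique _ _ _ Hth).
    set (k := u r * Derive v r - v r * Derive u r) in *.
    rewrite Du, Dv. ring. }
assert (Htrig := sin2_cos2 (theta s)). unfold Rsqr in Htrig.
assert (Hs1 := Hunit s Hs).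
(* The squared distance of two unit vectors is 2 minus twice their inner product. *)
assert (Hsq : (u s - cos (theta s)) ^ 2 + (v s - sin (theta s)) ^ 2 = 0) by nra.
assert (H1 := pow2_ge_0 (u s - cos (theta s))).
assert (H2 := pow2_ge_0 (v s - sin (theta s))).
split; apply Rminus_diag_uniq, Rsqr_0_uniq; unfold Rsqr; lra.
Qed.

(** * Recovering the generating curve *)

Lemma Ck_on_interval_2 (a b : Rbar) (f : R -> R) (s : R) :
  Ck_on_interval 2 a b f -> in_interval a b s ->
  ex_derive f s /\ ex_derive (Derive f) s /\ continuous (Derive (Derive f)) s.
Proof.
intros Hf Hs. repeat split.
- apply (Hf 1%nat s); [lia | easy].
- apply (Hf 2%nat s); [lia | easy].
- apply (Hf 2%nat s); [lia | easy].
Qed.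

Lemma eta1_eq (a b : Rbar) (x y : R -> R) (s : R) :
  Ck_on_interval 2 a b x -> Ck_on_interval 2 a b y -> in_interval a b s ->
  eta1 x y s = - (x s * Derive x s + y s * Derive y s).
Proof.
intros Hx Hy Hs.
destruct (Ck_on_interval_2 a b x s Hx Hs) as [Hx1 _].
destruct (Ck_on_interval_2 a b y s Hy Hs) as [Hy1 _].
unfold eta1.
rewrite (is_derive_unique _ s (2 * (x s * Derive x s + y s * Derive y s))).
- field.
- auto_derive; [easy |]. change (Derive (fun t => x t)) with (Derive x).
  change (Derive (fun t => y t)) with (Derive y). ring.
Qed.

(** In the derivative of [eta2 = x y' - y x'] the products [x' y'] cancel; Frenet's
    equations turn the rest into the curvature times the tangential component. *)
Lemma Derive_eta2 (a b : Rbar) (x y : R -> R) (s : R) :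
  arc_length_curve a b x y -> in_interval a b s ->
  Derive (eta2 x y) s =
  - (Derive x s * Derive (Derive y) s - Derive y s * Derive (Derive x) s)
  * eta1 x y s.
Proof.
intros [Hx [Hy Hunit]] Hs.
rewrite (eta1_eq a b x y s Hx Hy Hs).
destruct (Ck_on_interval_2 a b x s Hx Hs) as [Hx1 [Hx2 _]].
destruct (Ck_on_interval_2 a b y s Hy Hs) as [Hy1 [Hy2 _]].
destruct (unit_field_derive a b (Derive x) (Derive y) s Hunit Hs Hx2 Hy2)
  as [Dx Dy].
rewrite (is_derive_unique (eta2 x y) s
           (x s * Derive (Derive y) s - y s * Derive (Derive x) s)).
- set (k := Derive x s * Derive (Derive y) s - Derive y s * Derive (Derive x) s)
    in *.
  rewrite Dx, Dy. ring.
- unfold eta2. auto_derive; [easy |].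
  change (Derive (fun t => x t)) with (Derive x).
  change (Derive (fun t => y t)) with (Derive y).
  change (Derive (fun t => Derive x t)) with (Derive (Derive x)).
  change (Derive (fun t => Derive y t)) with (Derive (Derive y)). ring.
Qed.

Lemma Cexp_opp_Ci (t : R) : Cexp (- (Ci * t)) = (cos t, - sin t).
Proof.
unfold Cexp.
replace (Re (- (Ci * t))%C) with 0 by (simpl; ring).
replace (Im (- (Ci * t))%C) with (- t) by (simpl; ring).
rewrite exp_0, cos_neg, sin_neg.
apply injective_projections; simpl; ring.
Qed.

(** Minus the tangent angle is a determination of the integral of [d eta2 / eta1],
    and it recovers the curve. *)
Lemma exists_recovering_integral (a b : Rbar) (x y : R -> R) :
  arc_length_curve a b x y ->
  exists Phi : R -> R,
    indefinite_integral a b (eta1 x y) (eta2 x y) Phi /\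
    forall s : R, in_interval a b s ->
      (x s + Ci * y s = - (eta1 x y s + Ci * eta2 x y s) * Cexp (- (Ci * Phi s)))%C.
Proof.
intros Hxy. assert (H := Hxy). destruct H as [Hx [Hy Hunit]].
pose (kappa s :=
  Derive x s * Derive (Derive y) s - Derive y s * Derive (Derive x) s).
destruct (exists_angle a b (Derive x) (Derive y)) as [theta Htheta];
  [| | exact Hunit |].
{ intros s Hs. exact (proj2 (Ck_on_interval_2 a b x s Hx Hs)). }
{ intros s Hs. exact (proj2 (Ck_on_interval_2 a b y s Hy Hs)). }
exists (fun s => - theta s).
assert (HD : forall s, in_interval a b s ->
               is_derive (fun s => - theta s) s (- kappa s)).
{ intros s Hs. now apply (is_derive_opp theta s (kappa s)), Htheta. }
split; [split |].
- intros j s Hj Hs.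
  assert (Hex : ex_derive (fun s => - theta s) s) by (eexists; now apply HD).
  destruct j as [| [| j]]; [| | lia]; split.
  + easy.
  + now apply (ex_derive_continuous (fun s => - theta s)).
  + easy.
  + destruct (Ck_on_interval_2 a b x s Hx Hs) as [_ [Hx1 Hx2]].
    destruct (Ck_on_interval_2 a b y s Hy Hs) as [_ [Hy1 Hy2]].
    apply (continuous_ext_loc _ (fun t => - kappa t)).
    * apply (filter_imp (in_interval a b)); [| now apply in_interval_locally].
      intros t Ht. symmetry. now apply is_derive_unique, HD.
    * apply (continuous_opp kappa). unfold kappa.
      now apply (continuous_angular_speed (Derive x) (Derive y)).
- intros s Hs Hne.
  rewrite (Derive_eta2 a b x y s Hxy Hs), (is_derive_unique _ _ _ (HD s Hs)).
  unfold kappa. now field.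
- intros s Hs. destruct (Htheta s Hs) as [_ [Hc Hsn]].
  assert (Hs1 := Hunit s Hs).
  rewrite Cexp_opp_Ci, cos_neg, sin_neg, <- Hc, <- Hsn, (eta1_eq a b x y s Hx Hy Hs).
  unfold eta2. apply injective_projections; simpl.
  + transitivity (x s * (Derive x s ^ 2 + Derive y s ^ 2)); [rewrite Hs1 |]; ring.
  + transitivity (y s * (Derive x s ^ 2 + Derive y s ^ 2)); [rewrite Hs1 |]; ring.
Qed.

Theorem proposition3p1
  (gamma : R * R * R -> R) (g : R -> R)
  (Hgamma : anisotropic_energy_density gamma)
  (Hg : axially_symmetric gamma g)
  (omega c : R)
  (a b : Rbar) (x y : R -> R)
  (Hxy : arc_length_curve a b x y)
  (X : R -> R -> C * R)
  (HX : forall s theta : R, in_interval a b s ->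
          X s theta = helicoidal_surface omega c x y s theta)
  (Lambda A : R)
  (Heq : forall s : R, in_interval a b s ->
     Lambda * (eta1 x y s ^ 2 + eta2 x y s ^ 2)
     + 2 * eta2 x y s
       / (mu2 g (omega * eta1 x y s / sqrt (1 + omega ^ 2 * eta1 x y s ^ 2))
          * sqrt (1 + omega ^ 2 * eta1 x y s ^ 2))
     + A = 0) :
  (exists Phi : R -> R,
     indefinite_integral a b (eta1 x y) (eta2 x y) Phi /\
     forall s : R, in_interval a b s ->
       (x s + Ci * y s = - (eta1 x y s + Ci * eta2 x y s) * Cexp (- (Ci * Phi s)))%C)
  /\
  (densely_nonzero a b (eta1 x y) ->
   forall Phi : R -> R,
     indefinite_integral a b (eta1 x y) (eta2 x y) Phi ->
     exists phi0 : R,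
       forall s : R, in_interval a b s ->
         (x s + Ci * y s
          = - (eta1 x y s + Ci * eta2 x y s) * Cexp (- (Ci * (Phi s + phi0)%R)))%C).
Proof.
destruct (exists_recovering_integral a b x y Hxy) as [Psi [HPsi Hrec]].
split; [now exists Psi |].
intros Hd Phi HPhi.
destruct (indefinite_integral_unique _ _ _ _ Phi Psi Hd HPhi HPsi) as [phi0 Hphi0].
exists phi0. intros s Hs.
rewrite <- (Hphi0 s Hs). now apply Hrec.
Qed.
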